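(* For all integers $n\ge 12$ with $n\equiv0\pmod 4$, $$\sqrt{(n-3)(n-4)(n-12)}\ \le\ \nu_n^*\ \le\ n\sqrt{n-3},$$ so that $\nu_n^*=n^{3/2}-O(\sqrt n)$, and $(\nu_n^*+n)-n^{3/2}\sim n$ as $n\to\infty$ (through multiples of $4$) in the sense that $$\lim_{n\to\infty}\frac{(\nu_n^*+n)-n^{3/2}}{n}=1.$$ In fact, for all $n\ge 88$ (with $n\equiv 0\pmod 4$), $$\nu_n^*+n>n^{3/2}.$$
   Context: For integers $n\ge 4$ with $n\equiv 0\pmod 4$, define $$\nu_n^*:=\frac{\bar\rho_n(n-3)}{2}+\frac{(n-4)(n-12)}{2\bar\rho_n},$$ where $$\bar\rho_n:=\begin{cases} 8\left\lceil \dfrac{n}{8\sqrt{n-3}}\right\rceil-4, & \text{if } n\equiv 0\pmod 8,\\[2ex] 8\left\lceil \dfrac{n}{8\sqrt{n-3}}-\dfrac12\right\rceil_+, & \text{if } n\equiv 4\pmod 8.\end{cases}$$ Here $\lceil x\rceil$ denotes the least integer greater than or equal to $x$, and $\lceil x\rceil_+$ denotes the least positive integer greater than or equal to $x$. *)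

(* Defs.v *)
From HB Require Import structures.
From mathcomp Require Import all_boot all_order all_algebra.
From mathcomp Require Import all_classical all_reals all_analysis.

Set Implicit Arguments.
Unset Strict Implicit.
Unset Printing Implicit Defensive.

Import Order.TTheory GRing.Theory Num.Theory.
Import numFieldNormedType.Exports.

Local Open Scope ring_scope.

Lemma ex_pos_nat_ge (R : realType) (x : R) :
  exists m : nat, (0 < m)%N && (x <= m%:R).
Proof. by exists (Num.truncn x).+1; rewrite ltW // truncnS_gt. Qed.

Definition ceil_pos (R : realType) (x : R) : nat := ex_minn (ex_pos_nat_ge x).

(* Meant for n >= 4 divisible by 4, so that the last branch is the case
   n = 4 mod 8. *)
Definition rho_bar (R : realType) (n : nat) : R :=
  if (8 %| n)%N
  then 8 * (Num.ceil (n%:R / (8 * Num.sqrt (n%:R - 3)) : R))%:~R - 4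
  else 8 * (ceil_pos (n%:R / (8 * Num.sqrt (n%:R - 3)) - 1 / 2 : R))%:R.

Definition nu_star (R : realType) (n : nat) : R :=
  rho_bar R n * (n%:R - 3) / 2
  + (n%:R - 4) * (n%:R - 12) / (2 * rho_bar R n).

(* Main.v *)
Require Import Defs.
From mathcomp Require Import all_boot all_order all_algebra.
From mathcomp Require Import ring lra.
From mathcomp Require Import all_classical all_reals all_analysis.
Import Order.TTheory GRing.Theory Num.Theory.
Import numFieldNormedType.Exports.
Local Open Scope classical_set_scope.
Local Open Scope ring_scope.

(** Write [s] for the square root of [n - 3] and [f r] for
    [r (n - 3) / 2 + (n - 4) (n - 12) / (2 r)], so that [nu_star] is
    [f (rho_bar)].  Since [(n - 4) (n - 12) = n ^ 2 - 16 s ^ 2],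
    [f r = n s - ((4 s) ^ 2 - (r s - n) ^ 2) / (2 r)],
    so for [r > 0] the bound [f r <= n s] says exactly that [r] lies within [4]
    of [n / s].  Now [rho_bar] is obtained from [n / s] by rounding to a lattice
    of step [8], and the window from [n / s - 4] to [n / s + 4] has length [8], so the
    upper bound always holds ([rho_bar_near]).  The lower bound is the
    arithmetic-geometric mean inequality for the two terms of [f].

    Everything else follows from these two bounds.  Since [(n - 4) (n - 12)]
    is at least [(n - 12) ^ 2], the lower bound gives [s (n - 12) <= nu_star];
    the upper bound gives [nu_star <= n s <= n * sqrt n].  As
    [n ^ (3 / 2) = n * sqrt n] and [sqrt n - s = 3 / (sqrt n + s)], the gap
    [n ^ (3 / 2) - nu_star] is between [0] and
    [n (sqrt n - s) + 12 s <= 15 * sqrt n] ([pow32_sub_nu_star]).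
    This yields both asymptotic claims.  The last inequality needs the sharp
    lower bound: after squaring twice it becomes
    [(10 n ^ 2 - 48 n + 72) ^ 2 < n ^ 5], a polynomial inequality that holds
    from [90] on.  It fails at [88], where the lower bound is too weak; but
    there [rho_bar = 12] and [nu_star = 776] exactly. *)

(** * The rounding that defines rho_bar *)

Lemma ceil_pos_ge (R : realType) (x : R) : x <= (ceil_pos x)%:R.
Proof. by rewrite /ceil_pos; case: ex_minnP => m /andP[]. Qed.

Lemma ceil_pos_gt0 (R : realType) (x : R) : (0 < ceil_pos x)%N.
Proof. by rewrite /ceil_pos; case: ex_minnP => m /andP[]. Qed.

(** Nonnegativity is what makes the positive ceiling behave like the usual one
    up to a weak inequality: at [0] it is [1]. *)
Lemma ceil_pos_le (R : realType) (x : R) : 0 <= x -> (ceil_pos x)%:R <= x + 1.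
Proof.
move=> x0; rewrite /ceil_pos; case: ex_minnP => -[|[|m]] /andP[// _ _] minm.
  by rewrite lerDr.
rewrite leNgt; apply/negP => ltm.
suff /minm : (0 < m.+1)%N && (x <= m.+1%:R) by rewrite ltnn.
by move: ltm; rewrite -natr1 ltrD2r => /ltW ->.
Qed.

Lemma sqr_sqrtB3 (R : realType) (n : nat) : (12 <= n)%N ->
  Num.sqrt (n%:R - 3 : R) ^+ 2 = n%:R - 3.
Proof. by rewrite -(ler_nat R) => n12; rewrite sqr_sqrtr//; lra. Qed.

Lemma sqrtB3_gt0 (R : realType) (n : nat) : (12 <= n)%N ->
  0 < Num.sqrt (n%:R - 3 : R).
Proof. by rewrite -(ler_nat R) => n12; rewrite sqrtr_gt0; lra. Qed.

(** Squared, this is [(n - 4) (n - 12) >= 0].  It keeps the window around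
    [n / s] free of negative numbers, and it makes the argument of [ceil_pos] in
    [rho_bar] nonnegative, so that [ceil_pos_le] applies. *)
Lemma sqrtB3_le (R : realType) (n : nat) : (12 <= n)%N ->
  4 * Num.sqrt (n%:R - 3 : R) <= n%:R.
Proof.
move=> n12; have s2 := sqr_sqrtB3 R n n12; have s0 := sqrtB3_gt0 R n n12.
move: n12; rewrite -(ler_nat R) => n12.
rewrite -(@ler_pXn2r _ 2)// ?nnegrE; [nra|lra|lra].
Qed.

(** In both residue classes [rho_bar] is [8 c + k] where [c] rounds up
    [x - (k + 4) / 8], [x = n / (8 s)], so that it lies between [8 x - 4] and
    [8 x + 4]. *)
Lemma rho_bar_near (R : realType) (n : nat) : (12 <= n)%N ->
  let s := Num.sqrt (n%:R - 3 : R) in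
  0 < rho_bar R n /\ `|rho_bar R n * s - n%:R| <= 4 * s.
Proof.
move=> n12 s; have s0 : 0 < s := sqrtB3_gt0 R n n12.
have s4 : 4 * s <= n%:R := sqrtB3_le R n n12.
rewrite /rho_bar -/s; set x := n%:R / (8 * s).
have xs : x * s = n%:R / 8 by rewrite /x; field; lra.
have x_ge : 2^-1 <= x by rewrite -(ler_pM2r s0) xs; lra.
suff near_of (r : R) : 8 * x - 4 <= r <= 8 * x + 4 -> `|r * s - n%:R| <= 4 * s.
  case: ifP => _.
    have /andP[lec gec] := ceil_itv x.
    rewrite intrD in lec.
    have c1 : (1 : R) <= (Num.ceil x)%:~R.
      by rewrite -[1]/(1%:~R) ler_int -gtz0_ge1 ceil_gt0; lra.
    by split; [lra|apply: near_of; apply/andP; split; lra].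
  have y0 : 0 <= x - 1 / 2 by lra.
  have ley := ceil_pos_le R _ y0; have gey := ceil_pos_ge R (x - 1 / 2).
  have := ceil_pos_gt0 R (x - 1 / 2); rewrite -(ltr_nat R) => c0.
  by split; [lra|apply: near_of; apply/andP; split; lra].
move=> /andP[ler ger].
have xs_shift c : (8 * x + c) * s = n%:R + c * s.
  by rewrite mulrDl -(mulrA 8) xs; field.
have : (8 * x - 4) * s <= r * s by rewrite ler_pM2r.
have : r * s <= (8 * x + 4) * s by rewrite ler_pM2r.
rewrite !xs_shift => gers lers.
by rewrite ler_norml; apply/andP; split; lra.
Qed.

(** * Bounds on nu_star *)

Lemma nu_star_le (R : realType) (n : nat) : (12 <= n)%N ->
  nu_star R n <= n%:R * Num.sqrt (n%:R - 3).
Proof.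
move=> n12; have [r0 near_r] := rho_bar_near R n n12.
have s2 := sqr_sqrtB3 R n n12; have s0 := sqrtB3_gt0 R n n12.
rewrite /nu_star; move: s2 s0 r0 near_r.
set s := Num.sqrt _; set r := rho_bar R n.
move: (n%:R : R) => N s2 s0 r0 near_r.
have -> : r * (N - 3) / 2 + (N - 4) * (N - 12) / (2 * r)
        = N * s - ((4 * s) ^+ 2 - (r * s - N) ^+ 2) / (2 * r).
  have -> : (N - 4) * (N - 12) = N ^+ 2 - 16 * s ^+ 2 by rewrite s2; ring.
  by rewrite -s2; field; lra.
rewrite lerBlDr lerDl divr_ge0 ?subr_ge0//; last lra.
by rewrite -[leLHS]real_normK ?num_real// ler_pXn2r ?nnegrE//; lra.
Qed.

Lemma nu_star_ge (R : realType) (n : nat) : (12 <= n)%N ->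
  Num.sqrt ((n%:R - 3) * (n%:R - 4) * (n%:R - 12)) <= nu_star R n.
Proof.
move=> n12; have [r0 _] := rho_bar_near R n n12.
move: n12; rewrite -(ler_nat R) /nu_star; set r := rho_bar R n in r0 *.
move: (n%:R : R) => N N12.
set A := r * (N - 3) / 2; set B := (N - 4) * (N - 12) / (2 * r).
have A0 : 0 <= A by rewrite /A divr_ge0// mulr_ge0//; lra.
have B0 : 0 <= B by rewrite /B divr_ge0//; [apply: mulr_ge0|]; lra.
(* [4 A B <= (A + B) ^ 2], as the difference is [(A - B) ^ 2] *)
have -> : (N - 3) * (N - 4) * (N - 12) = 4 * (A * B).
  by rewrite /A /B; field; lra.
have AB0 : 0 <= A + B by lra.
rewrite -[leRHS](ger0_norm AB0) -sqrtr_sqr ler_wsqrtr//.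
by have := sqr_ge0 (A - B); nra.
Qed.

(** * Comparison with n^(3/2) *)

Lemma powR32 (R : realType) (x : R) : 0 < x -> x `^ (3 / 2) = x * Num.sqrt x.
Proof.
move=> x0; have -> : 3 / 2 = 1 + 2^-1 :> R by lra.
by rewrite powRD ?gt_eqF ?implybT// powRr1 ?powR12_sqrt// ltW.
Qed.

Lemma pow32_sub_nu_star (R : realType) (n : nat) : (12 <= n)%N ->
  `|n%:R `^ (3 / 2) - nu_star R n| <= 15 * Num.sqrt (n%:R : R).
Proof.
move=> n12; have leU := nu_star_le R n n12; have leL := nu_star_ge R n n12.
have s2 := sqr_sqrtB3 R n n12; have s0 := sqrtB3_gt0 R n n12.
move: n12; rewrite -(ler_nat R) => n12.
rewrite powR32; last lra.
move: s2 s0 leU leL n12; set s := Num.sqrt (_ - 3); set nu := nu_star R n.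
move: (n%:R : R) => N s2 s0 leU leL N12.
have t2 : Num.sqrt N ^+ 2 = N by rewrite sqr_sqrtr//; lra.
have t0 : 0 < Num.sqrt N by rewrite sqrtr_gt0; lra.
set t := Num.sqrt N in t2 t0 *.
have st : s <= t by rewrite -(@ler_pXn2r _ 2)// ?nnegrE ?s2 ?t2; lra.
have snu : s * (N - 12) <= nu.
  apply: le_trans leL.
  have e0 : 0 <= s * (N - 12) by rewrite mulr_ge0//; lra.
  rewrite -[leLHS](ger0_norm e0) -sqrtr_sqr ler_wsqrtr//.
  rewrite exprMn s2 -mulrA expr2 ler_wpM2l ?ler_wpM2r//; lra.
(* [t - s = 3 / (t + s) <= 3 / t], multiplied by [N = t ^ 2] *)
have Nts : N * (t - s) <= 3 * t.
  have -> : N * (t - s) = t * (t * (t - s)) by rewrite -{1}t2; ring.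
  rewrite [leRHS]mulrC ler_pM2l//.
  have : (t - s) * (t + s) = 3 by rewrite -subr_sqr t2 s2; ring.
  by have := mulr_ge0 (ltW s0) (_ : 0 <= t - s); rewrite subr_ge0; nra.
have Nst : N * s <= N * t by rewrite ler_wpM2l//; lra.
by rewrite ger0_norm; lra.
Qed.

(** Squaring [N t - N < nu] once and cancelling [N ^ 3], where [t ^ 2 = N],
    leaves [10 N ^ 2 - 48 N + 72 < N ^ 2 t]; squaring again removes [t], and
    expanding the result around [90] gives positive coefficients only. *)
Lemma pow32_lt_nu_star_ge90 (R : realType) (n : nat) : (90 <= n)%N ->
  n%:R `^ (3 / 2) < nu_star R n + n%:R :> R.
Proof.
move=> n90; have n12 : (12 <= n)%N by apply: leq_trans n90.
have leL := nu_star_ge R n n12.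
move: n90; rewrite -(ler_nat R) => n90; rewrite powR32; last lra.
move: leL n90; set nu := nu_star R n; move: (n%:R : R) => N leL N90.
have t2 : Num.sqrt N ^+ 2 = N by rewrite sqr_sqrtr//; lra.
have t0 : 0 < Num.sqrt N by rewrite sqrtr_gt0; lra.
set t := Num.sqrt N in t2 t0 *.
have t1 : 1 <= t by rewrite -(@ler_pXn2r _ 2)// ?nnegrE ?expr1n; lra.
have key : 10 * N ^+ 2 - 48 * N + 72 < N ^+ 2 * t.
  have P0 : 0 <= 10 * N ^+ 2 - 48 * N + 72 by nra.
  have Q0 : 0 <= N ^+ 2 * t by rewrite mulr_ge0 ?sqr_ge0// ltW.
  rewrite -(@ltr_pXn2r _ 2)// exprMn t2 -subr_gt0.
  have [u [u0 ->]] : exists u, 0 <= u /\ N = u + 90.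
    by exists (N - 90); split; [lra|ring].
  have u2 : 0 <= u ^+ 2 by exact: exprn_ge0.
  have u3 : 0 <= u ^+ 3 by exact: exprn_ge0.
  have u4 : 0 <= u ^+ 4 by exact: exprn_ge0.
  have u5 : 0 <= u ^+ 5 by exact: exprn_ge0.
  lra.
rewrite -ltrBlDr; apply: lt_le_trans leL.
have e0 : 0 <= N * t - N by rewrite -[X in _ - X]mulr1 -mulrBr mulr_ge0//; lra.
rewrite -[ltLHS](ger0_norm e0) -sqrtr_sqr ltr_sqrt; last first.
  by rewrite !mulr_gt0//; lra.
have -> : (N * t - N) ^+ 2 = N ^+ 3 + N ^+ 2 - 2 * (N ^+ 2 * t).
  have -> : (N * t - N) ^+ 2
          = N ^+ 2 * t ^+ 2 + N ^+ 2 - 2 * (N ^+ 2 * t) by ring.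
  by rewrite t2; ring.
rewrite -subr_gt0.
have -> : (N - 3) * (N - 4) * (N - 12) - (N ^+ 3 + N ^+ 2 - 2 * (N ^+ 2 * t))
        = 2 * (N ^+ 2 * t - (10 * N ^+ 2 - 48 * N + 72)) by ring.
by rewrite pmulr_rgt0// subr_gt0.
Qed.

Lemma rho_bar_88 (R : realType) : rho_bar R 88 = 12.
Proof.
set s := Num.sqrt (88 - 3 : R).
have s2 : s ^+ 2 = 85 by rewrite /s sqr_sqrtr; lra.
have s0 : 0 <= s := sqrtr_ge0 _.
have [s9 s10] : 9 <= s /\ s <= 10 by split; nra.
have -> : rho_bar R 88 = 8 * (Num.ceil (88 / (8 * s)))%:~R - 4 by [].
have -> : Num.ceil (88 / (8 * s)) = 2; last by lra.
apply: ceil_def; rewrite ltr_pdivlMr ?ler_pdivrMr; lra.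
Qed.

Lemma pow32_lt_nu_star (R : realType) (n : nat) : (88 <= n)%N -> (4 %| n)%N ->
  n%:R `^ (3 / 2) < nu_star R n + n%:R :> R.
Proof.
move=> n88 n4; have [n90|] := leqP 90 n; first exact: pow32_lt_nu_star_ge90.
move=> n90; have -> : n = 88%N.
  apply/eqP; rewrite eqn_leq n88 andbT.
  move: n90 n4; rewrite ltnS leq_eqVlt.
  by case/predU1P => [->|].
rewrite /nu_star rho_bar_88 powR32//.
have t2 : Num.sqrt (88 : R) ^+ 2 = 88 by rewrite sqr_sqrtr.
have t0 : 0 <= Num.sqrt (88 : R) := sqrtr_ge0 _.
(* [nu_star R 88 + 88 = 864], and [88 * (19 / 2) = 836] *)
have : Num.sqrt (88 : R) < 19 / 2 by nra.
lra.
Qed.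

Theorem proposition4p4 (R : realType) :
  [/\ forall n : nat, (12 <= n)%N -> (4 %| n)%N ->
        Num.sqrt ((n%:R - 3) * (n%:R - 4) * (n%:R - 12)) <= nu_star R n
          <= n%:R * Num.sqrt (n%:R - 3),
      (fun n : nat => n%:R `^ (3 / 2) - nu_star R n)
        =O_ (within [set n : nat | (4 %| n)%N] \oo)
          (fun n : nat => Num.sqrt (n%:R : R)),
      (nu_star R n + n%:R - n%:R `^ (3 / 2)) / n%:R
        @[n --> within [set n : nat | (4 %| n)%N] \oo] --> (1 : R)
    & forall n : nat, (88 <= n)%N -> (4 %| n)%N ->
        n%:R `^ (3 / 2) < nu_star R n + n%:R].
Proof.
split.
- by move=> n n12 _; rewrite nu_star_ge// nu_star_le.
- apply/eqO_exP; exists 15 => //; rewrite near_withinE.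
  near=> n => _ /=; rewrite (ger0_norm (sqrtr_ge0 _)).
  by apply: pow32_sub_nu_star; near: n; exact: nbhs_infty_ge.
- apply/cvgrPdist_le => e e0; rewrite near_withinE.
  near=> n => _ /=.
  have n12 : (12 <= n)%N by near: n; exact: nbhs_infty_ge.
  have n0 : 0 < n%:R :> R by rewrite ltr0n (leq_trans _ n12).
  have gap := pow32_sub_nu_star R n n12.
  have t_ge : 15 / e <= Num.sqrt (n%:R : R).
    have q0 : 0 <= 15 / e by rewrite divr_ge0// ltW.
    rewrite -[leLHS](ger0_norm q0) -sqrtr_sqr ler_wsqrtr//.
    by near: n; exact: nbhs_infty_ger.
  have -> : 1 - (nu_star R n + n%:R - n%:R `^ (3 / 2)) / n%:R
          = (n%:R `^ (3 / 2) - nu_star R n) / n%:R :> R.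
    by field; rewrite gt_eqF.
  rewrite normrM normfV (gtr0_norm n0) ler_pdivrMr//; apply: le_trans gap _.
  have nE : n%:R = Num.sqrt n%:R ^+ 2 :> R by rewrite sqr_sqrtr ?ltW.
  rewrite [in leRHS]nE expr2 mulrA ler_wpM2r ?sqrtr_ge0//.
  by rewrite mulrC -ler_pdivrMr.
- exact: pow32_lt_nu_star.
Unshelve. all: by end_near.
Qed.
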